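(* Let $p<q$ be primes, both congruent to $3\bmod 4$, let $s,t\ge 2$, and let $a$ be an integer coprime to $pq$. If $a$ is a square modulo $p$, then $c_2(a;p^tq^s)<1$. If $a$ is not a square modulo $p$, then $c_2(a;p^tq^s)>1$.
   Context: For $n\ge2$ and $a$ coprime to $n$, $H_2(a;n)=\{(x,y)\in\mathbb{Z}^2: xy\equiv a \bmod n,\ 1\le x,y<n\}$, $\bar{S}_2(a;n)=\{x+y \bmod n:(x,y)\in H_2(a;n)\}$, $\bar{D}_2(a;n)=\{x-y \bmod n:(x,y)\in H_2(a;n)\}$, and $c_2(a;n)=\#\bar{S}_2(a;n)/\#\bar{D}_2(a;n)$. *)

(* Defs.v *)
From HB Require Import structures.
From mathcomp Require Import all_boot all_order all_algebra.

Set Implicit Arguments.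
Unset Strict Implicit.
Unset Printing Implicit Defensive.

Import Order.TTheory GRing.Theory Num.Theory.

Local Open Scope ring_scope.

(* The points of H_2(a; n) have 1 <= x, y < n, so their coordinates are encoded
   as nonzero elements of 'I_n. *)
Definition H2 (a : int) (n : nat) : {set 'I_n * 'I_n} :=
  [set xy : 'I_n * 'I_n |
    [&& (1 <= xy.1)%N, (1 <= xy.2)%N &
        ((xy.1 : nat)%:Z * (xy.2 : nat)%:Z == a %[mod n%:Z])%Z]].

(* Residues modulo n are taken in 'Z_n, which is Z/nZ only for n >= 2. *)
Definition S2bar (a : int) (n : nat) : {set 'Z_n} :=
  [set ((xy.1 : nat)%:R + (xy.2 : nat)%:R : 'Z_n) | xy : 'I_n * 'I_n in H2 a n].

Definition D2bar (a : int) (n : nat) : {set 'Z_n} :=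
  [set ((xy.1 : nat)%:R - (xy.2 : nat)%:R : 'Z_n) | xy : 'I_n * 'I_n in H2 a n].

Definition c2 (a : int) (n : nat) : rat :=
  #|S2bar a n|%:R / #|D2bar a n|%:R.

Definition square_mod (a : int) (m : nat) : Prop :=
  exists b : int, (b ^+ 2 = a %[mod m%:Z])%Z.

(* Main.v *)
Require Import Defs.
From HB Require Import structures.
From mathcomp Require Import all_boot all_order all_algebra.
From mathcomp Require Import finfield zify ring.

Set Implicit Arguments.
Unset Strict Implicit.
Unset Printing Implicit Defensive.

Import Order.TTheory GRing.Theory Num.Theory.

Local Open Scope ring_scope.

(** The sums x + y with xy = a form a set whose size is multiplicative in
    coprime moduli, and the differences for a are the sums for -a; since -1 is
    not a square modulo p or q, exactly one of a, -a is a square modulo each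
    prime.  Modulo p^t, the map x |-> x + a/x is exactly two-to-one on the units
    with x^2 <> a mod p, because (x - y)(xy - a) = 0 forces x = y or xy = a when
    x - y and xy - a are not both divisible by p.  The units with x^2 = a mod p
    contribute v further sums; modulo p^2 these only depend on x mod p, so
    0 < v <= 2p^(t-2) if a is a square mod p.  Hence twice the number of sums is
    p^(t-1)(p-1) for a nonsquare and p^(t-1)(p-3) + 2v for a square, and the
    theorem reduces to comparing these for p and q, where q >= p + 4. *)

(** * Counting by fibres *)

Lemma card_sum_fibres (T T' : finType) (f : T -> T') (A : {set T})
    (B : {set T'}) :
  (forall x, x \in A -> f x \in B) ->
  #|A| = (\sum_(y in B) #|[set x in A | f x == y]|)%N.
Proof.
move=> fAB; rewrite -sum1_card (partition_big f (mem B)) //=.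
by apply: eq_bigr => y _; rewrite -sum1dep_card.
Qed.

(** The fibre of [f] through [y] is [[set y; g y]], a genuine pair since [g] fixes no point of
    [A]. *)
Lemma card_imset_2to1 (T T' : finType) (f : T -> T') (g : T -> T)
    (A : {set T}) :
  (forall x, x \in A -> g x \in A) -> (forall x, x \in A -> g x != x) ->
  (forall x y, x \in A -> y \in A -> (f x == f y) = (x == y) || (x == g y)) ->
  #|A| = (#|f @: A| * 2)%N.
Proof.
move=> gA gx fE.
rewrite (@card_sum_fibres _ _ f A (f @: A)); last first.
  by move=> x xA; apply: imset_f.
rewrite -sum_nat_const; apply: eq_bigr => _ /imsetP[y yA ->].
have -> : [set x in A | f x == f y] = [set y; g y].
  apply/setP=> x; rewrite !inE.
  have [xA|] /= := boolP (x \in A); first by rewrite fE.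
  by move=> xA; apply/esym; apply: contraNF xA => /orP[] /eqP->; rewrite ?gA.
by rewrite cards2 eq_sym gx.
Qed.

(** Every fibre of [f] is a translate of the kernel; comparing with [A = setT] shows that the kernel
    has [k] elements. *)
Lemma card_preimset_rmorph (R T : finNzRingType) (f : {rmorphism R -> T})
    (k : nat) (A : {set T}) :
  (forall y, exists x, f x = y) -> #|R| = (k * #|T|)%N ->
  #|f @^-1: A| = (k * #|A|)%N.
Proof.
move=> f_surj cardR.
have fib y : #|[set x | f x == y]| = #|[set x | f x == 0]|.
  have [x0 <-] := f_surj y.
  rewrite -(card_imset [set x | f x == 0] (addIr x0)).
  apply: eq_card => x; rewrite inE; apply/idP/imsetP => [/eqP fx|[u]].
    by exists (x - x0); rewrite ?subrK // inE rmorphB fx subrr.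
  by rewrite inE => /eqP fu ->; rewrite rmorphD fu add0r.
have cardE (B : {set T}) : #|f @^-1: B| = (#|[set x | f x == 0%R]| * #|B|)%N.
  rewrite (@card_sum_fibres _ _ f _ B); last by move=> x; rewrite inE.
  rewrite mulnC -sum_nat_const; apply: eq_bigr => y yB; rewrite -(fib y).
  by apply: eq_card => x; rewrite !inE; case: eqP => [->|]; rewrite ?yB ?andbF.
have := cardE setT; rewrite preimsetT !cardsT cardR => /eqP.
have cT : (0 < #|T|)%N by apply/card_gt0P; exists 0.
by rewrite eqn_pmul2r // => /eqP kE; rewrite cardE -kE.
Qed.

(** * Sums of factorizations and the Chinese remainder theorem *)

(** One notion serves for sums and differences: [x - y] with [x * y = a] is the sum of [x] and
    [- y], whose product is [- a]. *)
Definition factor_sums (R : finComNzRingType) (a : R) : {set R} :=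
  [set x.1 + x.2 | x : R * R & x.1 * x.2 == a].

Lemma factor_sumsP (R : finComNzRingType) (a z : R) :
  reflect (exists x y, x * y = a /\ z = x + y) (z \in factor_sums a).
Proof.
apply: (iffP imsetP) => [[[x y]]|[x [y [xy ->]]]].
  by rewrite inE /= => /eqP xy ->; exists x, y.
by exists (x, y); rewrite // inE xy.
Qed.

(** Joint injectivity and equal cardinalities make [(f, g)] a bijection onto [R1 * R2], so
    factorizations can be chosen independently in the two components. *)
Lemma card_factor_sums_prod (R R1 R2 : finComNzRingType)
    (f : {rmorphism R -> R1}) (g : {rmorphism R -> R2}) (a : R) :
  (forall x y, f x = f y -> g x = g y -> x = y) ->
  #|R| = (#|R1| * #|R2|)%N ->
  #|factor_sums a| = (#|factor_sums (f a)| * #|factor_sums (g a)|)%N.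
Proof.
move=> fg_inj cardR; pose h x := (f x, g x).
have h_inj : injective h by move=> x y [/fg_inj]; apply.
have h_surj u : exists x, h x = u.
  have : u \in codom h by apply/inj_card_onto; rewrite ?card_prod ?cardR.
  by case/codomP=> x ->; exists x.
rewrite -cardsX -(card_imset _ h_inj); apply: eq_card => -[z1 z2].
rewrite inE /=; apply/imsetP/andP=> [[_ /factor_sumsP[x [y [xy ->]]] [-> ->]]|].
  by split; apply/factor_sumsP; [exists (f x), (f y)|exists (g x), (g y)];
    rewrite -rmorphM -rmorphD xy.
case=> /factor_sumsP[x1 [y1 [xy1 ->]]] /factor_sumsP[x2 [y2 [xy2 ->]]].
have [x [fx gx]] := h_surj (x1, x2); have [y [fy gy]] := h_surj (y1, y2).
exists (x + y); last by rewrite /h !rmorphD fx fy gx gy.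
by apply/factor_sumsP; exists x, y; split=> //; apply: fg_inj;
  rewrite rmorphM ?fx ?fy ?gx ?gy.
Qed.

(** * Factor sums in a finite ring over its residue field *)

Section LocalRing.

Variables (R : finComUnitRingType) (F : finFieldType).
Variables (pi : {rmorphism R -> F}) (k : nat) (a : R).
Hypothesis pi_surj : forall c, exists x, pi x = c.
Hypothesis unit_pi : forall x, pi x != 0 -> x \is a GRing.unit.
Hypothesis cardR : #|R| = (k * #|F|)%N.
Hypothesis two_neq0 : 2 != 0 :> F.
Hypothesis a_neq0 : pi a != 0.

(** Each factorization of [a] is [(x, a / x)] with [x] a unit. [U] collects the units for which [x]
    and [a / x] have distinct residues, [V] those for which the residues agree. *)
Let f (x : R) : R := x + a / x.
Let U : {set R} := pi @^-1: [set c : F | (c != 0) && (c ^+ 2 != pi a)].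
Let V : {set R} := pi @^-1: [set c : F | c ^+ 2 == pi a].

Let V_neq0 x : x \in V -> pi x != 0.
Proof.
by rewrite !inE => /eqP xa; apply: contraNneq a_neq0 => x0; rewrite -xa x0 expr0n.
Qed.

Let factor_sumsE : factor_sums a = f @: U :|: f @: V.
Proof.
apply/setP=> z; rewrite inE; apply/factor_sumsP/orP=> [[x [y [xy ->]]]|].
  have x0 : pi x != 0.
    by apply: contraNneq a_neq0 => x0; rewrite -xy rmorphM x0 mul0r.
  have -> : x + y = f x by rewrite /f -xy mulrAC divrr ?mul1r ?unit_pi.
  have [xa|xa] := eqVneq (pi x ^+ 2) (pi a).
    by right; apply: imset_f; rewrite !inE xa.
  by left; apply: imset_f; rewrite !inE x0.
case=> /imsetP[x xUV ->]; exists x, (a / x); split=> //.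
  by rewrite mulrC divrK // unit_pi //; move: xUV; rewrite !inE => /andP[].
by rewrite mulrC divrK // unit_pi // V_neq0.
Qed.

Let f_eq x y : pi x != 0 -> pi y != 0 -> (x - y) * (x * y - a) = (f x - f y) * (x * y).
Proof.
move=> /unit_pi ux /unit_pi uy; rewrite /f.
transitivity ((x - y) * (x * y) + (a / x * x * y - x * (a / y * y))).
  by rewrite !divrK //; ring.
by ring.
Qed.

(* If f x = f y with y^2 = a mod p, then (x - y)^2 y = 0 mod p. *)
Let fUV : [disjoint f @: U & f @: V].
Proof.
apply/pred0P=> z /=; apply/negP=> /andP[/imsetP[x xU ->] /imsetP[y yV fxy]].
have y0 := V_neq0 yV; move: xU yV; rewrite !inE => /andP[x0 xa] /eqP ya.
have := f_eq x0 y0; rewrite fxy subrr mul0r => /(congr1 pi).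
rewrite rmorph0 rmorphM !rmorphB rmorphM -ya => /eqP.
have -> : (pi x - pi y) * (pi x * pi y - pi y ^+ 2) = (pi x - pi y) ^+ 2 * pi y.
  by ring.
rewrite mulf_eq0 (negPf y0) orbF expf_eq0 /= subr_eq0 => /eqP xy.
by move: xa; rewrite xy ya eqxx.
Qed.

Let pi_div x : pi x != 0 -> pi (a / x) = pi a / pi x.
Proof.
by move=> x0; apply: (canRL (mulfK x0)); rewrite -rmorphM divrK // unit_pi.
Qed.

Let cardU : (#|U| = #|f @: U| * 2)%N.
Proof.
have ua := unit_pi a_neq0.
apply: (@card_imset_2to1 _ _ _ (fun x => a / x)) => [x|x|x y];
  rewrite !inE => /andP[x0 xa].
- rewrite pi_div // mulf_neq0 ?invr_neq0 //=.
  apply: contra xa => /eqP e; apply/eqP/(mulfI a_neq0).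
  by rewrite -{1}e; field.
- apply: contraNneq xa => e; have := pi_div x0; rewrite e expr2 => {2}->.
  by rewrite mulrC divfK.
move=> /andP[y0 ya]; have ux := unit_pi x0; have uy := unit_pi y0.
apply/eqP/orP=> [fxy|[/eqP->//|/eqP->]]; last first.
  rewrite /f addrC; congr (_ + _).
  by rewrite invrM ?unitrV // invrK mulrCA mulrV ?mulr1.
have := f_eq x0 y0; rewrite fxy subrr mul0r => e.
(* If the residues agree, [x * y - a] has residue [pi x ^+ 2 - pi a], nonzero on [U], so it is a
   unit and cancels; otherwise [x - y] is a unit and cancels. *)
have [xy|xy] := eqVneq (pi x) (pi y).
  left; rewrite -subr_eq0; apply/eqP/(@mulIr _ (x * y - a)).
    by rewrite unit_pi // rmorphB rmorphM -xy -expr2 subr_eq0.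
  by rewrite mul0r.
right; have uxy : x - y \is a GRing.unit by rewrite unit_pi // rmorphB subr_eq0.
have /eqP : x * y - a = 0 by apply: (mulrI uxy); rewrite mulr0.
by rewrite subr_eq0 => /eqP <-; rewrite mulrK.
Qed.

Lemma double_card_factor_sums_nonsquare :
  (forall c, c ^+ 2 != pi a) -> (#|factor_sums a| * 2 = k * (#|F| - 1))%N.
Proof.
move=> nsq; have V0 : V = set0 by apply/setP=> x; rewrite !inE (negPf (nsq _)).
rewrite factor_sumsE V0 imset0 setU0 -cardU (card_preimset_rmorph _ pi_surj cardR).
congr (_ * _)%N; rewrite subn1 -(cardsC1 (0 : F)).
by apply: eq_card => c; rewrite !inE nsq andbT.
Qed.

(** In the application [rho] is reduction modulo [p ^ 2], which kills products of two multiples of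
    [p]. The number [v] is the size of [f @: V]: residues on [V] are [b] or [- b], so [f @: V] meets
    at most two fibres of [rho], each of size [k']. *)
Lemma double_card_factor_sums_square (T : finNzRingType)
    (rho : {rmorphism R -> T}) (k' : nat) (b : F) :
  (forall y, exists x, rho x = y) -> #|R| = (k' * #|T|)%N ->
  (forall x y, pi x = 0 -> pi y = 0 -> rho (x * y) = 0) ->
  b ^+ 2 = pi a ->
  exists2 v, (0 < v <= 2 * k')%N &
    (#|factor_sums a| * 2 = k * (#|F| - 3) + 2 * v)%N.
Proof.
move=> rho_surj cardT rho0 ba.
have b0 : b != 0 by apply: contraNneq a_neq0 => b0; rewrite -ba b0 expr0n.
have bN : b != - b.
  by rewrite -subr_eq0 opprK -mulr2n -mulr_natl mulf_neq0.
have sqb c : (c ^+ 2 == pi a) = (c == b) || (c == - b).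
  by rewrite -ba eqf_sqr.
exists #|f @: V|.
  apply/andP; split.
    have [x xb] := pi_surj b; apply/card_gt0P; exists (f x).
    by apply: imset_f; rewrite !inE xb ba.
  have [x1 x1b] := pi_surj b; have [x2 x2b] := pi_surj (- b).
  have fV : f @: V \subset rho @^-1: [set rho (f x1); rho (f x2)].
    apply/subsetP=> _ /imsetP[x xV ->]; rewrite !inE.
    (* Both [x - y] and [x * y - a] have residue zero, so [rho] kills the left side of [f_eq], and
       the unit [x * y] cancels on the right. *)
    have key y : pi x = pi y -> rho (f x) == rho (f y).
      move=> xy; have x0 := V_neq0 xV.
      have y0 : pi y != 0 by rewrite -xy.
      have := f_eq x0 y0; move/(congr1 rho); rewrite rho0; last first.
      - by move: xV; rewrite !inE rmorphB rmorphM -xy -expr2 => /eqP->; rewrite subrr.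
      - by rewrite rmorphB xy subrr.
      have uxy : x * y \is a GRing.unit by rewrite unitrM !unit_pi.
      move=> e; rewrite -subr_eq0 -rmorphB -(mulrK uxy (f x - f y)).
      by rewrite (rmorphM rho) -e mul0r.
    have := xV; rewrite !inE sqb => /orP[] /eqP xb; apply/orP.
      by left; apply: key; rewrite xb.
    by right; apply: key; rewrite xb.
  apply: leq_trans (subset_leq_card fV) _.
  rewrite (card_preimset_rmorph _ rho_surj cardT) mulnC leq_mul2r cards2.
  by case: (_ != _); rewrite orbT.
rewrite factor_sumsE cardsU disjoint_setI0 // cards0 subn0 mulnDl -cardU.
rewrite (card_preimset_rmorph _ pi_surj cardR) (mulnC #|f @: V|).
congr (_ * _ + _)%N.
have -> : [set c : F | (c != 0) && (c ^+ 2 != pi a)] = ~: [set 0; b; - b].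
  by apply/setP=> c; rewrite !inE sqb -negb_or orbA.
have c3 : #|[set 0; b; - b]| = 3%N.
  by rewrite -setUA cardsU1 cards2 bN !inE negb_or eq_sym b0 eq_sym oppr_eq0 b0.
by rewrite cardsCs setCK c3.
Qed.

End LocalRing.

(** * The rings ['Z_n] and their reductions *)

Lemma natr_Zn_eq0 (n m : nat) : (1 < n)%N -> (m%:R == 0 :> 'Z_n) = (n %| m)%N.
Proof. by move=> n1; rewrite -val_eqE /= val_Zp_nat. Qed.

Lemma intr_Zn_eq0 (n : nat) (z : int) :
  (1 < n)%N -> (z%:~R == 0 :> 'Z_n) = (n%:Z %| z)%Z.
Proof.
move=> n1; have [m [->|->]] : exists m : nat, z = m%:Z \/ z = - m%:Z.
- by case: z => m; [exists m; left|exists m.+1; right].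
- by rewrite -pmulrn natr_Zn_eq0.
by rewrite mulrNz oppr_eq0 rpredN -pmulrn natr_Zn_eq0.
Qed.

Lemma card_Zn (n : nat) : (1 < n)%N -> #|'Z_n| = n.
Proof. by move=> n1; rewrite card_ord Zp_cast. Qed.

Lemma rmorphism_from_Zn (n : nat) (T : nzRingType) :
  (1 < n)%N -> n%:R = 0 :> T -> inhabited {rmorphism 'Z_n -> T}.
Proof.
move=> n1 nT; pose f (x : 'Z_n) : T := (x : nat)%:R.
have fE m : f m%:R = m%:R.
  by rewrite /f val_Zp_nat // [in RHS](divn_eq m n) natrD natrM nT mulr0 add0r.
have fD x y : f (x + y) = f x + f y.
  by rewrite -[x]natr_Zp -[y]natr_Zp -natrD !fE natrD.
have fB : zmod_morphism f.
  by move=> x y; apply/eqP; rewrite eq_sym subr_eq -fD subrK.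
have fM : monoid_morphism f.
  split; first exact: (fE 1%N).
  by move=> x y; rewrite -[x]natr_Zp -[y]natr_Zp -natrM !fE natrM.
pose am := GRing.isZmodMorphism.Build _ _ f fB.
pose mm := GRing.isMonoidMorphism.Build _ _ f fM.
exact: inhabits (HB.pack f am mm : {rmorphism 'Z_n -> T}).
Qed.

Lemma rmorph_Zn_surj (n m : nat) (f : {rmorphism 'Z_n -> 'Z_m}) (y : 'Z_m) :
  exists x, f x = y.
Proof. by exists (y : nat)%:R; rewrite rmorph_nat natr_Zp. Qed.

Lemma card_factor_sums_coprime (m n : nat) (a : int) :
  (1 < m)%N -> (1 < n)%N -> coprime m n ->
  #|factor_sums (a%:~R : 'Z_(m * n))| =
    (#|factor_sums (a%:~R : 'Z_m)| * #|factor_sums (a%:~R : 'Z_n)|)%N.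
Proof.
move=> m1 n1 cop; have mn1 : (1 < m * n)%N by rewrite (leq_trans m1) ?leq_pmulr 1?ltnW.
have [] : inhabited {rmorphism 'Z_(m * n) -> 'Z_m}.
  by apply: rmorphism_from_Zn => //; rewrite natrM pchar_Zp ?mul0r.
have [] : inhabited {rmorphism 'Z_(m * n) -> 'Z_n}.
  by apply: rmorphism_from_Zn => //; rewrite natrM pchar_Zp ?mulr0.
move=> g f; rewrite (@card_factor_sums_prod _ _ _ f g) ?card_Zn ?rmorph_int //.
move=> x y fxy gxy; apply/eqP; rewrite -subr_eq0 -[x - y]natr_Zp natr_Zn_eq0 //.
rewrite Gauss_dvd // -!natr_Zn_eq0 //.
by rewrite -(rmorph_nat f) -(rmorph_nat g) natr_Zp !rmorphB fxy gxy !subrr eqxx.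
Qed.

(** * Squares in fields of order 3 modulo 4 *)

(** With [#|F| = 4k + 3], the power [x ^+ (2k + 1)] of a nonzero [x] is 1 or -1 and changes sign
    with [x]. If it is 1, then [x ^+ (k + 1)] is a square root of [x]. *)
Lemma finField_square_opp (F : finFieldType) (c : F) :
  (#|F| = 3 %[mod 4])%N -> 2 != 0 :> F -> c != 0 ->
  (exists b, b ^+ 2 = - c) <-> ~ (exists b, b ^+ 2 = c).
Proof.
move=> F3 two_neq0 c0; pose k := (#|F| %/ 4)%N.
have FE : #|F| = ((2 * k + 1) * 2).+1.
  by rewrite (divn_eq #|F| 4) F3 -/k /=; lia.
have pow1 (x : F) : x != 0 -> x ^+ ((2 * k + 1) * 2) = 1.
  by move=> x0; apply: (mulfI x0); rewrite -exprS -FE expf_card mulr1.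
have pm (x : F) : x != 0 -> (x ^+ (2 * k + 1) == 1) || (x ^+ (2 * k + 1) == -1).
  by move=> x0; rewrite -sqrf_eq1 -exprM pow1.
have rootE (x : F) : x ^+ (2 * k + 1) = 1 -> (x ^+ k.+1) ^+ 2 = x.
  by move=> x1; rewrite -exprM (_ : (k.+1 * 2)%N = (2 * k + 1).+1) ?exprS ?x1 ?mulr1 //; lia.
have oddE (x : F) : (- x) ^+ (2 * k + 1) = - x ^+ (2 * k + 1).
  by rewrite exprNn -signr_odd oddD oddM /= mulN1r.
split=> [[b bc] [d dc]|nsq].
  have b0 : b != 0 by apply: contraNneq c0 => b0; rewrite -oppr_eq0 -bc b0 expr0n.
  have d0 : d != 0 by apply: contraNneq c0 => d0; rewrite -dc d0 expr0n.
  have := pow1 b b0; rewrite mulnC exprM bc oddE -dc -exprM mulnC pow1 //.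
  by move/eqP; rewrite eq_sym -subr_eq0 opprK (negPf two_neq0).
exists ((- c) ^+ k.+1); apply: (rootE (- c)); rewrite oddE.
have /orP[/eqP c1|/eqP->] := pm _ c0; last by rewrite opprK.
by case: nsq; exists (c ^+ k.+1); apply: (rootE c).
Qed.

(** * From integer points to residue rings *)

Lemma exp_gt1 (m n : nat) : (1 < m)%N -> (0 < n)%N -> (1 < m ^ n)%N.
Proof. by move=> m1 n0; rewrite -(exp1n n) ltn_exp2r. Qed.

Lemma imset_H2 (T : finType) (a : int) (n : nat) (g : 'Z_n -> 'Z_n -> T) :
  (1 < n)%N -> coprimez a n%:Z ->
  [set g (xy.1 : nat)%:R (xy.2 : nat)%:R | xy : 'I_n * 'I_n in H2 a n] =
  [set g x.1 x.2 | x : 'Z_n * 'Z_n & x.1 * x.2 == a%:~R].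
Proof.
(* For [n = m.+2] the types ['I_n] and ['Z_n] coincide. The bounds [1 <= x, y] then hold
   automatically, as a zero coordinate would force [n] to divide [a]. *)
case: n g => [|[|m]] // g n1 cop.
have a_ndvd : ~~ (m.+2%:Z %| a)%Z.
  apply: contraL cop; rewrite coprimez_sym coprimezE dvdzE => /gcdn_idPl.
  by rewrite /coprime => ->.
have H2E (x y : 'I_m.+2) : ((x, y) \in H2 a m.+2) = (x * y == a%:~R :> 'Z_m.+2).
  have -> : (x * y == a%:~R :> 'Z_m.+2) =
      ((x : nat)%:Z * (y : nat)%:Z == a %[mod m.+2%:Z])%Z.
    rewrite eqz_mod_dvd -intr_Zn_eq0 // mulrzBr intrM -!pmulrn subr_eq0.
    by rewrite !natr_Zp.
  rewrite inE /=; case: eqP => [e|]; last by rewrite !andbF.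
  rewrite andbT; apply/andP; split; rewrite lt0n; apply: contra a_ndvd => /eqP z;
    by move/eqP: e; rewrite z ?(mul0r, mulr0) eqz_mod_dvd sub0r rpredN.
by apply/setP=> z; apply/imsetP/imsetP=> -[[x y] xy ->]; exists (x, y);
  rewrite /= ?natr_Zp // ?H2E inE -?H2E // in xy *.
Qed.

Lemma S2bar_factor_sums (a : int) (n : nat) :
  (1 < n)%N -> coprimez a n%:Z -> S2bar a n = factor_sums (a%:~R : 'Z_n).
Proof. exact: (@imset_H2 _ a n +%R). Qed.

Lemma D2bar_factor_sums (a : int) (n : nat) :
  (1 < n)%N -> coprimez a n%:Z -> D2bar a n = factor_sums ((- a)%:~R : 'Z_n).
Proof.
move=> n1 cop; rewrite /D2bar (imset_H2 (fun x y : 'Z_n => x - y)) //.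
apply/setP=> z; apply/imsetP/factor_sumsP=> [[[x y]]|[x [y [xy ->]]]].
  by rewrite inE => /eqP xy ->; exists x, (- y); rewrite mulrN xy mulrNz.
by exists (x, - y); rewrite /= ?opprK // inE mulrN xy mulrNz opprK.
Qed.

Lemma square_modP (a : int) (p : nat) : prime p ->
  square_mod a p <-> exists b : 'F_p, b ^+ 2 = a%:~R.
Proof.
move=> pp; have E (b : int) : (b ^+ 2 = a %[mod p%:Z])%Z <-> (b%:~R ^+ 2 = a%:~R :> 'F_p).
  rewrite -(rmorphXn (intr : int -> 'F_p)) /=.
  split=> /eqP; rewrite ?eqz_mod_dvd => e; apply/eqP; rewrite ?eqz_mod_dvd; move: e;
    by rewrite (dvdz_pcharf (pchar_Fp pp)) mulrzBr subr_eq0.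
split=> [[b /E bE]|[b bE]]; first by exists b%:~R.
by exists (b : nat)%:Z; apply/E; rewrite -pmulrn natr_Zp.
Qed.

Lemma intr_Fp_neq0 (a : int) (p : nat) :
  prime p -> coprimez a p%:Z -> a%:~R != 0 :> 'F_p.
Proof.
move=> pp; rewrite -(dvdz_pcharf (pchar_Fp pp)) dvdzE -prime_coprime //.
by rewrite coprimez_sym coprimezE.
Qed.

Lemma two_Fp_neq0 (p : nat) : prime p -> (2 < p)%N -> 2 != 0 :> 'F_p.
Proof.
move=> pp p2; rewrite -(dvdn_pcharf (pchar_Fp pp)).
by rewrite gtnNdvd.
Qed.

Lemma square_modN (a : int) (p : nat) :
  prime p -> (p = 3 %[mod 4])%N -> coprimez a p%:Z ->
  square_mod (- a) p <-> ~ square_mod a p.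
Proof.
move=> pp p3 cop; have p2 : (2 < p)%N by lia.
have := @finField_square_opp 'F_p a%:~R; rewrite card_Fp // => /(_ p3).
move=> /(_ (two_Fp_neq0 pp p2) (intr_Fp_neq0 pp cop)) E.
have := square_modP a pp; have := square_modP (- a) pp; rewrite mulrNz.
by tauto.
Qed.

(** * Counts modulo prime powers *)

(** The kernels of reduction from ['Z_(p ^ t)] to ['F_p] and to ['Z_(p ^ 2)] have sizes [p * k] and
    [k], the two multiplicities in the local counts. *)
Lemma card_factor_sums_prime_power (p t : nat) (a : int) :
  prime p -> (2 < p)%N -> (2 <= t)%N -> coprimez a p%:Z ->
  let N := #|factor_sums (a%:~R : 'Z_(p ^ t))| in
  let k := (p ^ (t - 2))%N in
  (square_mod a p -> exists2 v, (0 < v <= 2 * k)%N &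
     (N * 2 = p * k * (p - 3) + 2 * v)%N) /\
  (~ square_mod a p -> (N * 2 = p * k * (p - 1))%N).
Proof.
move=> pp p2 t2 cop N k.
have ptE : (p ^ t = k * p ^ 2)%N by rewrite -expnD subnK.
have pt1 : (1 < p ^ t)%N by rewrite exp_gt1 //; lia.
have psq1 : (1 < p ^ 2)%N by rewrite exp_gt1 //; lia.
have [pi] : inhabited {rmorphism 'Z_(p ^ t) -> 'F_p}.
  apply: rmorphism_from_Zn => //.
  by rewrite ptE natrM natrX pchar_Fp_0 // expr0n mulr0.
have [rho] : inhabited {rmorphism 'Z_(p ^ t) -> 'Z_(p ^ 2)}.
  by apply: rmorphism_from_Zn => //; rewrite ptE natrM pchar_Zp ?mulr0.
have pi_eq0 x : (pi x == 0) = (p %| x)%N.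
  by rewrite -{1}[x]natr_Zp rmorph_nat (dvdn_pcharf (pchar_Fp pp)).
have cardR : #|'Z_(p ^ t)| = (p * k * #|'F_p|)%N.
  by rewrite card_Zn // card_Fp // ptE; lia.
have cardR2 : #|'Z_(p ^ t)| = (k * #|'Z_(p ^ 2)|)%N by rewrite !card_Zn.
have unit_pi x : pi x != 0 -> x \is a GRing.unit.
  rewrite pi_eq0 -prime_coprime // => px.
  by rewrite -[x]natr_Zp unitZpE // coprimeXl.
have pi_surj c : exists x, pi x = c by exact: rmorph_Zn_surj.
have rho0 x y : pi x = 0 -> pi y = 0 -> rho (x * y) = 0.
  move=> /eqP; rewrite pi_eq0 => px /eqP; rewrite pi_eq0 => py; apply/eqP.
  rewrite -[x]natr_Zp -[y]natr_Zp -natrM rmorph_nat natr_Zn_eq0 //.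
  exact: dvdn_mul.
have a0 : pi a%:~R != 0 by rewrite rmorph_int intr_Fp_neq0.
have two0 := two_Fp_neq0 pp p2.
split=> sq.
  have [b] := (square_modP a pp).1 sq; rewrite -(rmorph_int pi) => ba.
  have := double_card_factor_sums_square pi_surj unit_pi cardR two0 a0
    (@rmorph_Zn_surj _ _ rho) cardR2 rho0 ba.
  by rewrite card_Fp.
have := double_card_factor_sums_nonsquare pi_surj unit_pi cardR a0.
rewrite card_Fp //; apply=> c; apply/eqP=> ca; apply: sq; apply/square_modP => //.
by exists c; rewrite ca rmorph_int.
Qed.

(** * Comparison of the counts and conclusion *)

Lemma square_nonsquare_count_ineq (p q k l v w : nat) :
  (2 < p)%N -> (p + 4 <= q)%N -> (0 < k)%N -> (0 < l)%N ->
  (v <= 2 * k)%N -> (0 < w)%N ->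
  ((p * k * (p - 3) + 2 * v) * (q * l * (q - 1)) <
   (p * k * (p - 1)) * (q * l * (q - 3) + 2 * w))%N.
Proof.
move=> p2 pq k0 l0 vk w0.
have [m Dp] : exists m, p = (m + 3)%N by exists (p - 3)%N; lia.
have [r Dq] : exists r, q = (p + 4 + r)%N by exists (q - (p + 4))%N; lia.
have -> : (q - 1 = m + 6 + r)%N by lia.
have -> : (q - 3 = m + 4 + r)%N by lia.
have -> : (p - 3 = m)%N by lia.
have -> : (p - 1 = m + 2)%N by lia.
(* The right side exceeds the left by [4m + r(2m + 2)]. Equality occurs for [p = 3], [q = 7], so
   strictness has to come from [w > 0]. *)
have key : ((p * m + 4) * (m + 6 + r) <= p * (m + 2) * (m + 4 + r))%N.
  by rewrite Dp; nia.
have le1 : (p * k * m + 2 * v <= k * (p * m + 4))%N by lia.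
apply: (@leq_ltn_trans (k * (p * m + 4) * (q * l * (m + 6 + r)))).
  by rewrite leq_mul2r le1 orbT.
apply: (@leq_ltn_trans (p * k * (m + 2) * (q * l * (m + 4 + r)))).
  have -> : (k * (p * m + 4) * (q * l * (m + 6 + r)) =
             k * q * l * ((p * m + 4) * (m + 6 + r)))%N by ring.
  have -> : (p * k * (m + 2) * (q * l * (m + 4 + r)) =
             k * q * l * (p * (m + 2) * (m + 4 + r)))%N by ring.
  by rewrite leq_mul2l key orbT.
by rewrite ltn_pmul2l ?muln_gt0; lia.
Qed.

Lemma square_count_lt_nonsquare (p k v : nat) :
  (2 < p)%N -> (0 < k)%N -> (v <= 2 * k)%N ->
  (p * k * (p - 3) + 2 * v < p * k * (p - 1))%N.
Proof.
move=> p2 k0 vk; have -> : (p - 1 = p - 3 + 2)%N by lia.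
rewrite mulnDr ltn_add2l; nia.
Qed.

(** The factor at [p] is smaller for [a] than for [- a]. If [a] is a square modulo [q], so is the
    factor at [q]; otherwise the factor at [q] favours [a], and the gap at [p] outweighs it because
    [p] is the smaller prime. *)
Lemma card_factor_sums_square_lt (p q s t : nat) (a : int) :
  prime p -> prime q -> (p < q)%N ->
  (p = 3 %[mod 4])%N -> (q = 3 %[mod 4])%N -> (2 <= s)%N -> (2 <= t)%N ->
  coprimez a (p * q)%N%:Z -> square_mod a p ->
  (#|factor_sums (a%:~R : 'Z_(p ^ t * q ^ s))| <
   #|factor_sums ((- a)%:~R : 'Z_(p ^ t * q ^ s))|)%N.
Proof.
move=> pp pq ltpq p3 q3 s2 t2 cop sq.
have [p2 p4q] : (2 < p)%N /\ (p + 4 <= q)%N by lia.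
have q2 : (2 < q)%N by lia.
have /andP[cp cq] : coprimez a p%:Z && coprimez a q%:Z.
  by move: cop; rewrite PoszM coprimezMr.
have cNp : coprimez (- a) p%:Z by rewrite coprimeNz.
have cNq : coprimez (- a) q%:Z by rewrite coprimeNz.
have cpq : coprime (p ^ t) (q ^ s).
  by rewrite coprimeXl // coprimeXr // prime_coprime // dvdn_prime2 //; lia.
have k0 : (0 < p ^ (t - 2))%N by rewrite expn_gt0 prime_gt0.
have l0 : (0 < q ^ (s - 2))%N by rewrite expn_gt0 prime_gt0.
rewrite !card_factor_sums_coprime // ?exp_gt1 //; try lia.
have [Ep _] := card_factor_sums_prime_power pp p2 t2 cp.
have [_ ENp] := card_factor_sums_prime_power pp p2 t2 cNp.
have [Eq Eq'] := card_factor_sums_prime_power pq q2 s2 cq.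
have [ENq ENq'] := card_factor_sums_prime_power pq q2 s2 cNq.
have {Ep} [v /andP[_ vk] Ep] := Ep sq.
have {}ENp := ENp (fun h => (square_modN pp p3 cp).1 h sq).
(* One factor 2 goes to each prime, since the local counts are known doubled. *)
rewrite -(@ltn_pmul2r (2 * 2)) // !(mulnACA _ _ 2) Ep ENp.
have [/existsP[b /eqP bq]|nsq] := boolP [exists b : 'F_q, b ^+ 2 == a%:~R].
  have sq_q : square_mod a q by apply/square_modP => //; exists b.
  have [w /andP[_ wl] ->] := Eq sq_q.
  rewrite ENq' => [|/square_modN]; last by apply.
  by apply: ltn_mul; apply: square_count_lt_nonsquare.
have nsq_q : ~ square_mod a q.
  by move/(square_modP a pq) => [b bq]; case/existsP: nsq; exists b; rewrite bq.
rewrite (Eq' nsq_q); have [|w /andP[w0 _] ->] := ENq; first exact/square_modN.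
exact: square_nonsquare_count_ineq.
Qed.

Theorem theorem3p9 (p q s t : nat) (a : int)
  (hp : prime p) (hq : prime q) (hpq : (p < q)%N)
  (hp3 : (p = 3 %[mod 4])%N) (hq3 : (q = 3 %[mod 4])%N)
  (hs : (2 <= s)%N) (ht : (2 <= t)%N)
  (ha : coprimez a (p * q)%N%:Z) :
  (square_mod a p -> c2 a (p ^ t * q ^ s)%N < 1) /\
  (~ square_mod a p -> c2 a (p ^ t * q ^ s)%N > 1).
Proof.
have pt1 : (1 < p ^ t)%N by rewrite exp_gt1 ?prime_gt1 //; lia.
have n1 : (1 < p ^ t * q ^ s)%N.
  by rewrite (leq_trans pt1) // leq_pmulr // expn_gt0 prime_gt0.
have [cp cq] : coprimez a p%:Z /\ coprimez a q%:Z.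
  by apply/andP; move: ha; rewrite PoszM coprimezMr.
have cn : coprimez a (p ^ t * q ^ s)%N%:Z.
  by rewrite PoszM coprimezMr !coprimezE !coprimeXr -?coprimezE.
rewrite /c2 S2bar_factor_sums // D2bar_factor_sums //.
have lt := card_factor_sums_square_lt hp hq hpq hp3 hq3 hs ht.
split=> [sq|nsq].
  have {}lt := lt a ha sq.
  by rewrite ltr_pdivrMr ?mul1r ?ltr_nat ?ltr0n // (leq_ltn_trans _ lt).
(* Passing to [- a] exchanges sums and differences, which reduces to the square case. *)
have sqN : square_mod (- a) p by apply/square_modN.
have {}lt := lt (- a); rewrite coprimeNz opprK in lt.
rewrite ltr_pdivlMr ?mul1r ?ltr_nat ?lt //.
(* Here the strict inequality does not make the denominator positive; the factorization of [- a] as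
   [- a] times 1 does. *)
rewrite ltr0n; apply/card_gt0P; exists ((- a)%:~R + 1).
by apply/factor_sumsP; exists (- a)%:~R, 1; rewrite mulr1.
Qed.
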